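(* Let $r$ be a positive integer with $r \equiv 3 \pmod 4$ and $3 \nmid r$. Then for every integer $k \geq 0$, $(\mathcal{F}_{10,k+rj})_{j=0}^\infty$ is a reverse quasi-Fibonacci subsequence; that is, for all $j \in \mathbb{Z}$, $$\mathcal{F}_{10,k+r(j+1)} + \mathcal{F}_{10,k+rj} \equiv \mathcal{F}_{10,k+r(j-1)} \pmod{10}.$$
   Context: The Fibonacci numbers are $F_0=0$, $F_1=1$, $F_n=F_{n-1}+F_{n-2}$, extended to all $n\in\mathbb{Z}$ by the same recurrence. For $n \in \mathbb{Z}$, $\mathcal{F}_{10,n} \in \{0,1,\ldots,9\}$ is the least nonnegative residue of $F_n$ modulo $10$. ''Reverse quasi-Fibonacci subsequence'' means exactly that the displayed recurrence holds for all $j\in\mathbb{Z}$. *)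

(* Defs.v *)
From mathcomp Require Import all_boot all_order all_algebra.
From mathcomp Require Import zify.

Set Implicit Arguments.
Unset Strict Implicit.
Unset Printing Implicit Defensive.

Import Order.TTheory GRing.Theory Num.Theory.
Local Open Scope ring_scope.

Fixpoint fib_nat (n : nat) : int :=
  if n is n1.+1 then
    if n1 is n2.+1 then fib_nat n1 + fib_nat n2 else 1
  else 0.

(* [fib_opp n] is F_(-n): the recurrence run backwards,
   F_(-(n+2)) = F_(-n) - F_(-(n+1)), from F_0 = 0 and F_(-1) = F_1 - F_0 = 1. *)
Fixpoint fib_opp (n : nat) : int :=
  if n is n1.+1 then
    if n1 is n2.+1 then fib_opp n2 - fib_opp n1 else 1
  else 0.

(* [Negz n] is the integer -(n+1). *)
Definition fib (n : int) : int :=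
  match n with
  | Posz n => fib_nat n
  | Negz n => fib_opp n.+1
  end.

Definition fib10 (n : int) : int := (fib n %% 10)%Z.

(* Together with F_0 = 0 and F_1 = 1, this characterizes [fib]. *)
Lemma fib_rec (n : int) : fib n = fib (n - 1) + fib (n - 2).
Proof.
case: n => [[|[|n]]|n] //.
- have -> : n.+2%:Z - 1 = n.+1%:Z by lia.
  by have -> : n.+2%:Z - 2 = n%:Z by lia.
- have -> : Negz n - 1 = Negz n.+1 by lia.
  have -> : Negz n - 2 = Negz n.+2 by lia.
  by rewrite /fib -[fib_opp n.+3]/(fib_opp n.+1 - fib_opp n.+2) addrC subrK.
Qed.

Lemma fib10_lt (n : int) : 0 <= fib10 n < 10.
Proof. by rewrite /fib10 modz_ge0 // ltz_pmod. Qed.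

(* Main.v *)
Require Import Defs.
From mathcomp Require Import all_boot all_order all_algebra.
From mathcomp Require Import zify ring.

(** For the Lucas numbers L_m one has F_(n+m) + (-1)^m F_(n-m) = L_m F_n. For odd
    m = r the recurrence therefore reduces to L_r = -1 modulo 10. The sequence L
    modulo 10 has period 12, and r = 7 or 11 modulo 12, where L_7 = 29 and
    L_11 = 199. *)

Set Implicit Arguments.
Unset Strict Implicit.
Unset Printing Implicit Defensive.

Import Order.TTheory GRing.Theory Num.Theory.
Local Open Scope ring_scope.

Fixpoint lucas (n : nat) : int :=
  if n is n1.+1 then
    if n1 is n2.+1 then lucas n1 + lucas n2 else 1
  else 2.

Lemma lucasSS (n : nat) : lucas n.+2 = lucas n.+1 + lucas n.
Proof. by []. Qed.

Lemma fibD (n : int) : fib (n + 2) = fib (n + 1) + fib n.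
Proof. by rewrite fib_rec addrK -addrA. Qed.

(** For fixed [n] both sides satisfy the Fibonacci recurrence in [m]: the sign (-1)^m turns the
    backward recurrence of F_(n-m) into the forward one. They agree at [m = 0] (2 F_n) and at
    [m = 1] (F_(n+1) - F_(n-1) = F_n). *)
Lemma fib_addsub_lucas (m : nat) (n : int) :
  fib (n + m%:Z) + (-1) ^+ m * fib (n - m%:Z) = lucas m * fib n.
Proof.
suff [] : fib (n + m%:Z) + (-1) ^+ m * fib (n - m%:Z) = lucas m * fib n /\
  fib (n + m.+1%:Z) + (-1) ^+ m.+1 * fib (n - m.+1%:Z) = lucas m.+1 * fib n by [].
elim: m => [|m [IH0 IH1]].
  split; first by rewrite !addr0 expr0 /=; ring.
  have := fibD (n - 1); have -> : n - 1 + 2 = n + 1 by lia.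
  by rewrite subrK expr1 /= => ->; ring.
split=> //; rewrite lucasSS mulrDl -IH1 -IH0.
(* Indices are counted up from n + m and from n - (m+2), so that [fibD] leaves four Fibonacci values
   and a ring identity. *)
have -> : n + m.+2%:Z = n + m%:Z + 2 by lia.
have -> : n + m.+1%:Z = n + m%:Z + 1 by lia.
have -> : n - m%:Z = n - m.+2%:Z + 2 by lia.
have -> : n - m.+1%:Z = n - m.+2%:Z + 1 by lia.
by rewrite !fibD !exprS; ring.
Qed.

(** The pair (L_12, L_13) = (322, 521) reduces to (L_0, L_1) = (2, 1), and two consecutive residues
    determine all later ones. *)
Lemma lucas_modD12 (n : nat) : (lucas (n + 12) = lucas n %[mod 10])%Z.
Proof.
suff [] : (lucas (n + 12) = lucas n %[mod 10])%Z /\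
  (lucas (n.+1 + 12) = lucas n.+1 %[mod 10])%Z by [].
elim: n => [|n [IH0 IH1]] //.
by split=> //; rewrite !addSn in IH1 *; rewrite !lucasSS -modzDm IH1 IH0 modzDm.
Qed.

Lemma lucas_mod12 (n : nat) : (lucas n = lucas (n %% 12)%N %[mod 10])%Z.
Proof.
rewrite {1}(divn_eq n 12) addnC; elim: (n %/ 12)%N => [|q IHq].
  by rewrite mul0n addn0.
by rewrite mulSn addnCA addnC lucas_modD12.
Qed.

Theorem theorem4p9 (r : nat) (r_gt0 : (0 < r)%N) (r_mod4 : r = 3 %[mod 4])
    (r_ndiv3 : ~~ (3 %| r)%N) (k : nat) (j : int) :
  (fib10 (k%:Z + r%:Z * (j + 1)) + fib10 (k%:Z + r%:Z * j)
    = fib10 (k%:Z + r%:Z * (j - 1)) %[mod 10])%Z.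
Proof.
rewrite /fib10 modzDm modz_mod.
set n := k%:Z + r%:Z * j.
have -> : k%:Z + r%:Z * (j + 1) = n + r%:Z by rewrite /n; ring.
have -> : k%:Z + r%:Z * (j - 1) = n - r%:Z by rewrite /n; ring.
have r_odd : odd r by lia.
have lucas_r : (lucas r = -1 %[mod 10])%Z.
  rewrite lucas_mod12.
  (* The remaining residue that is 3 modulo 4, namely 3 itself, would make [r] divisible by 3. *)
  by have [->|->] : (r %% 12 = 7 \/ r %% 12 = 11)%N by lia.
(* This is exact over the integers; the whole error is a multiple of L_r + 1, which [lucas_r] kills
   modulo 10. *)
have fib_addr : fib (n + r%:Z) + fib n = fib (n - r%:Z) + (lucas r + 1) * fib n.
  have := fib_addsub_lucas r n.
  rewrite -signr_odd r_odd expr1 => E; rewrite mulrDl -E; ring.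
rewrite fib_addr -modzDmr -modzMml -(modzDml (lucas r)) lucas_r.
by rewrite modzDml addNr mod0z mul0r mod0z addr0.
Qed.
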